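(* Let $m\ge 2$, $n\ge 1$ be integers, $\mathcal{A}\in S_{m,n}$ and $q\in\mathbb{R}^n$. If $\mathcal{A}$ is positive definite, then the solution set of TCP$(\mathcal{A},q)$ is contained in the set $$ B=\left\{x\in\mathbb{R}^n:\ \|x\|\le\left(\frac{\|q\|}{\lambda_{\min}}\right)^{\frac{1}{m-1}}\right\}, $$ where $\lambda_{\min}$ is the smallest Z-eigenvalue of $\mathcal{A}$.
   Context: $[n]=\{1,\ldots,n\}$ and $\|\cdot\|$ is the Euclidean ($2$-)norm. $S_{m,n}$ is the set of all real $m$th-order $n$-dimensional symmetric tensors, i.e. arrays $\mathcal{A}=(a_{i_1\ldots i_m})$ of real numbers with $i_1,\ldots,i_m\in[n]$ whose entries are invariant under any permutation of their indices. For a vector $x$, $\mathcal{A}x^{m-1}$ is the vector with components $(\mathcal{A}x^{m-1})_i=\sum_{i_2,\ldots,i_m=1}^{n}a_{ii_2\ldots i_m}x_{i_2}\cdots x_{i_m}$, and $\mathcal{A}x^m=\sum_{i_1,\ldots,i_m=1}^n a_{i_1\ldots i_m}x_{i_1}\cdots x_{i_m}$. $\mathcal{A}$ is positive definite if $\mathcal{A}x^m>0$ for all $x\in\mathbb{R}^n\setminus\{0\}$. Vector inequalities are componentwise. A real number $\lambda$ is a Z-eigenvalue of $\mathcal{A}$ if there is a real vector $x\in\mathbb{R}^n$ with $\mathcal{A}x^{m-1}=\lambda x$ and $x^\top x=1$. For a symmetric tensor, Z-eigenvalues always exist, and the smallest one satisfies $\lambda_{\min}=\min\{\mathcal{A}x^m: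 x\in\mathbb{R}^n,\ x^\top x=1\}$ (known facts). The tensor complementarity problem TCP$(\mathcal{A},q)$ is: find $x\in\mathbb{R}^n$ with $x\ge 0$, $\mathcal{A}x^{m-1}+q\ge 0$ and $x^\top(\mathcal{A}x^{m-1}+q)=0$; its solution set is the set of all such $x$. *)

(* Defs.v *)
From mathcomp Require Import all_boot all_order all_fingroup all_algebra.
From mathcomp Require Import all_classical all_reals all_analysis.

Set Implicit Arguments.
Unset Strict Implicit.
Unset Printing Implicit Defensive.
Import Order.TTheory GRing.Theory Num.Theory.
Local Open Scope classical_set_scope.
Local Open Scope ring_scope.

Definition tensor (R : Type) (m n : nat) : Type := m.-tuple 'I_n -> R.

Definition symmetric_tensor (R : realType) (m n : nat) (A : tensor R m n) :
    Prop :=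
  forall (s : 'S_m) (t : m.-tuple 'I_n), A [tuple tnth t (s k) | k < m] = A t.

(* In A x^(m-1), the sum over (i_2, ..., i_m) is written as a sum over the full
   multi-indices t = (i_1, ..., i_m) whose first index i_1 is i, so that no
   cast between m and (m - 1) + 1 is needed; behead t is (i_2, ..., i_m). *)
Definition tensor_apply (R : realType) (m n : nat) (A : tensor R m n)
    (x : 'cV[R]_n) : 'cV[R]_n :=
  \col_(i < n) \sum_(t : m.-tuple 'I_n | ohead t == Some i)
    A t * \prod_(j <- behead t) x j 0.

Definition tensor_form (R : realType) (m n : nat) (A : tensor R m n)
    (x : 'cV[R]_n) : R :=
  \sum_(t : m.-tuple 'I_n) A t * \prod_(j <- t) x j 0.

Definition positive_definite (R : realType) (m n : nat) (A : tensor R m n) :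
    Prop :=
  forall x : 'cV[R]_n, x != 0 -> 0 < tensor_form A x.

(* The library norm on matrices is the max norm, not the Euclidean one. *)
Definition enorm (R : realType) (n : nat) (x : 'cV[R]_n) : R :=
  Num.sqrt (\sum_(i < n) x i 0 ^+ 2).

Definition Z_eigenvalue (R : realType) (m n : nat) (A : tensor R m n)
    (lambda : R) : Prop :=
  exists x : 'cV[R]_n, tensor_apply A x = lambda *: x /\ x^T *m x = 1%:M.

Definition smallest_Z_eigenvalue (R : realType) (m n : nat) (A : tensor R m n)
    (lambda : R) : Prop :=
  Z_eigenvalue A lambda /\ forall mu : R, Z_eigenvalue A mu -> lambda <= mu.

Definition TCP_solutions (R : realType) (m n : nat) (A : tensor R m n)
    (q : 'cV[R]_n) : set 'cV[R]_n :=
  [set x : 'cV[R]_n | [/\ forall i, 0 <= x i 0,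
               forall i, 0 <= (tensor_apply A x + q) i 0 &
               x^T *m (tensor_apply A x + q) = 0]].

(* Main.v *)
Require Import Defs.
From mathcomp Require Import all_boot all_order all_fingroup all_algebra.
From mathcomp Require Import all_classical all_reals all_analysis.
From mathcomp Require Import ring lra.

Set Implicit Arguments.
Unset Strict Implicit.
Unset Printing Implicit Defensive.
Import Order.TTheory GRing.Theory Num.Theory.
Import numFieldNormedType.Exports.
Local Open Scope classical_set_scope.
Local Open Scope ring_scope.

(** The heart of the matter is the inequality
    [lambda_min * enorm x ^+ m <= tensor_form A x]
    ([smallest_Z_eigenvalue_le_form]).  Once it is known, complementarity reads
    [tensor_form A x = - dot x q], because [x^T (A x^(m-1)) = A x^m], and the
    Cauchy-Schwarz inequality bounds the right-hand side by
    [enorm x * enorm q].  Dividing by [enorm x] and by [lambda_min], which is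
    positive because it is the value of the form at a unit eigenvector, leaves
    [enorm x ^+ m.-1 <= enorm q / lambda_min], and one takes the root.

    The inequality holds because the form attains a minimum [mu] on the
    compact unit sphere, homogeneity spreads [mu * enorm y ^+ m <= A y^m] to
    all [y], and a minimiser [c] is a Z-eigenvector of eigenvalue [mu], so that
    [lambda_min <= mu] ([sphere_min_Z_eigenvalue]).  For this last point no
    Lagrange multiplier is needed.  Since [mu > 0], squaring gives
    [mu^2 * (y^T y)^m <= (A y^m)^2], an inequality between polynomials for every
    parity of [m], with equality at [c].  Along any line [c + s h] the
    difference is a nonnegative polynomial in [s] that vanishes at [0]; so does
    its derivative there, and by the symmetry of [A] this derivative is
    [2 mu m (h^T (A c^(m-1)) - mu h^T c)].  As [h] is arbitrary,
    [A c^(m-1) = mu c]. *)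

(** * Euclidean geometry of column vectors *)

Definition dot (R : realType) (n : nat) (u v : 'cV[R]_n) : R :=
  \sum_(i < n) u i 0 * v i 0.

Lemma mulmx_trE (R : realType) (n : nat) (u v : 'cV[R]_n) :
  u^T *m v = (dot u v)%:M.
Proof.
rewrite [LHS]mx11_scalar; congr _%:M.
by rewrite mxE; apply: eq_bigr => i _; rewrite mxE.
Qed.

Lemma mulmx_tr_scalar (R : realType) (n : nat) (u v : 'cV[R]_n) (a : R) :
  u^T *m v = a%:M -> dot u v = a.
Proof. by rewrite mulmx_trE => /matrixP/(_ 0 0); rewrite !mxE !mulr1n. Qed.

Lemma dotDr (R : realType) (n : nat) (u v w : 'cV[R]_n) :
  dot u (v + w) = dot u v + dot u w.
Proof. by rewrite -big_split; apply: eq_bigr => i _; rewrite mxE mulrDr. Qed.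

Lemma dotZr (R : realType) (n : nat) (a : R) (u v : 'cV[R]_n) :
  dot u (a *: v) = a * dot u v.
Proof. by rewrite mulr_sumr; apply: eq_bigr => i _; rewrite mxE mulrCA. Qed.

Lemma dotC (R : realType) (n : nat) (u v : 'cV[R]_n) : dot u v = dot v u.
Proof. by apply: eq_bigr => i _; rewrite mulrC. Qed.

Lemma dot_ge0 (R : realType) (n : nat) (u : 'cV[R]_n) : 0 <= dot u u.
Proof. by apply: sumr_ge0 => i _; rewrite -expr2 sqr_ge0. Qed.

Lemma dot_eq0 (R : realType) (n : nat) (u : 'cV[R]_n) :
  (dot u u == 0) = (u == 0).
Proof.
apply/idP/eqP => [|->]; last by rewrite /dot big1// => i _; rewrite mxE mul0r.
rewrite psumr_eq0 => [/allP u0|i _]; last by rewrite -expr2 sqr_ge0.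
apply/colP => i; rewrite mxE; apply/eqP; rewrite -sqrf_eq0 expr2.
exact/u0/mem_index_enum.
Qed.

Lemma enormE (R : realType) (n : nat) (u : 'cV[R]_n) :
  enorm u = Num.sqrt (dot u u).
Proof. by congr Num.sqrt; apply: eq_bigr => i _; rewrite expr2. Qed.

Lemma enorm_ge0 (R : realType) (n : nat) (u : 'cV[R]_n) : 0 <= enorm u.
Proof. exact: sqrtr_ge0. Qed.

Lemma sqr_enorm (R : realType) (n : nat) (u : 'cV[R]_n) :
  enorm u ^+ 2 = dot u u.
Proof. by rewrite enormE sqr_sqrtr// dot_ge0. Qed.

Lemma enorm_eq0 (R : realType) (n : nat) (u : 'cV[R]_n) :
  (enorm u == 0) = (u == 0).
Proof. by rewrite -sqrf_eq0 sqr_enorm dot_eq0. Qed.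

(** One half of Cauchy-Schwarz, from the squared length of
    [(v.v) u - (u.v) v], a multiple of the component of [u] orthogonal to
    [v]. *)
Lemma ler_oppdot_enorm (R : realType) (n : nat) (u v : 'cV[R]_n) :
  - dot u v <= enorm u * enorm v.
Proof.
have [->|v0] := eqVneq v 0.
  rewrite /dot big1 ?oppr0 ?mulr_ge0 ?enorm_ge0// => i _.
  by rewrite mxE mulr0.
have v_gt0 : 0 < dot v v by rewrite lt_def dot_eq0 v0 dot_ge0.
have : 0 <= dot (dot v v *: u + - dot u v *: v) (dot v v *: u + - dot u v *: v).
  exact: dot_ge0.
rewrite !(dotDr, dotZr) ![dot (_ + _) _]dotC !(dotDr, dotZr) [dot v u]dotC.
set a := dot u u; set b := dot v v; set c := dot u v => ineq.
have cab : c ^+ 2 <= (enorm u * enorm v) ^+ 2.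
  rewrite exprMn !sqr_enorm -/a -/b -(ler_pM2l v_gt0) -/b.
  rewrite -subr_ge0 (le_trans ineq)//.
  by rewrite [leLHS](_ : _ = b * (a * b) - b * c ^+ 2)//; ring.
apply: le_trans (ler_norm _) _; rewrite normrN.
by rewrite -(@ler_pXn2r _ 2)// ?nnegrE ?mulr_ge0 ?enorm_ge0// real_normK// num_real.
Qed.

(** * The form of a tensor and its gradient vector *)

Lemma tensor_formZ (R : realType) (m n : nat) (A : tensor R m n)
    (a : R) (x : 'cV[R]_n) :
  tensor_form A (a *: x) = a ^+ m * tensor_form A x.
Proof.
rewrite mulr_sumr; apply: eq_bigr => t _; rewrite mulrCA; congr (_ * _).
under eq_bigr do rewrite mxE.
by rewrite big_split/= big_const_seq count_predT size_tuple -Monoid.iteropE.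
Qed.

(** Pairing [A x^(m-1)] with [h] puts [h] in the first slot of the multilinear
    form and [x] in all the others. *)
Lemma dot_tensor_apply (R : realType) (m n : nat) (A : tensor R m.+1 n)
    (h x : 'cV[R]_n) :
  dot h (tensor_apply A x) =
  \sum_(t : m.+1.-tuple 'I_n)
    A t * (h (thead t) 0 * \prod_(j <- behead t) x j 0).
Proof.
rewrite [RHS](partition_big (@thead m 'I_n) predT)//=.
apply: eq_bigr => i _; rewrite mxE mulr_sumr.
apply: eq_big => [t|t]; case/tupleP: t => j t; rewrite ?theadE//=.
by move=> /eqP[->]; rewrite mulrCA.
Qed.

Lemma dot_tensor_apply_self (R : realType) (m n : nat) (A : tensor R m.+1 n)
    (x : 'cV[R]_n) :
  dot x (tensor_apply A x) = tensor_form A x.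
Proof.
rewrite dot_tensor_apply; apply: eq_bigr => t _.
by case/tupleP: t => j t; rewrite theadE /= big_cons.
Qed.

(** * The form along a line *)

Lemma deriv_prod (R : comNzRingType) (I : eqType) (r : seq I) (f : I -> {poly R}) :
  uniq r ->
  (\prod_(i <- r) f i)^`() = \sum_(i <- r) (f i)^`() * \prod_(j <- r | j != i) f j.
Proof.
elim: r => [|a r IHr]; first by rewrite !big_nil derivC.
move=> /= /andP[ar ur]; rewrite !big_cons eqxx/= derivM; congr (_ * _ + _).
  rewrite [RHS]big_seq_cond [LHS]big_seq_cond; apply: eq_bigl => i.
  by rewrite andbT; case ir: (i \in r) => //=; apply/esym; apply: contraNneq ar => <-.
rewrite IHr// mulr_sumr; apply: eq_big_seq => i ir.
have ai : a != i by apply: contraNneq ar => ->.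
by rewrite big_cons ai mulrCA.
Qed.

Definition line (R : realType) (n : nat) (x h : 'cV[R]_n) (i : 'I_n) :
    {poly R} :=
  (x i 0)%:P + h i 0 *: 'X.

Definition line_form (R : realType) (m n : nat) (A : tensor R m n)
    (x h : 'cV[R]_n) : {poly R} :=
  \sum_(t : m.-tuple 'I_n) (A t)%:P * \prod_(k < m) line x h (tnth t k).

Definition line_sqnorm (R : realType) (n : nat) (x h : 'cV[R]_n) : {poly R} :=
  \sum_(i < n) line x h i ^+ 2.

Lemma horner_line (R : realType) (n : nat) (x h : 'cV[R]_n) (i : 'I_n) (s : R) :
  (line x h i).[s] = (x + s *: h) i 0.
Proof. by rewrite !hornerE !mxE mulrC. Qed.

Lemma deriv_line (R : realType) (n : nat) (x h : 'cV[R]_n) (i : 'I_n) :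
  (line x h i)^`() = (h i 0)%:P.
Proof. by rewrite derivD derivC derivZ derivX add0r alg_polyC. Qed.

Lemma horner_line_form (R : realType) (m n : nat) (A : tensor R m n)
    (x h : 'cV[R]_n) (s : R) :
  (line_form A x h).[s] = tensor_form A (x + s *: h).
Proof.
rewrite horner_sum; apply: eq_bigr => t _.
rewrite hornerCM horner_prod big_tuple; congr (_ * _).
by apply: eq_bigr => k _; rewrite horner_line.
Qed.

Lemma horner_line_sqnorm (R : realType) (n : nat) (x h : 'cV[R]_n) (s : R) :
  (line_sqnorm x h).[s] = dot (x + s *: h) (x + s *: h).
Proof.
rewrite horner_sum; apply: eq_bigr => i _.
by rewrite horner_exp horner_line expr2.
Qed.

Lemma deriv_line_sqnorm (R : realType) (n : nat) (x h : 'cV[R]_n) :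
  (line_sqnorm x h)^`().[0] = 2 * dot h x.
Proof.
rewrite /line_sqnorm raddf_sum/= horner_sum mulr_sumr; apply: eq_bigr => i _.
by rewrite deriv_exp deriv_line expr1 hornerMn hornerCM horner_line scale0r addr0 mulr_natl.
Qed.

(** By the Leibniz rule the derivative is the sum, over the [m.+1] slots, of the
    multilinear form with [h] in that slot and [x] elsewhere.  Symmetry of [A]
    moves that slot to the front, so all these terms are equal. *)
Lemma deriv_line_form (R : realType) (m n : nat) (A : tensor R m.+1 n)
    (x h : 'cV[R]_n) :
  symmetric_tensor A ->
  (line_form A x h)^`().[0] = m.+1%:R * dot h (tensor_apply A x).
Proof.
move=> symA.
pose F (k : 'I_m.+1) (t : m.+1.-tuple 'I_n) :=
  h (tnth t k) 0 * \prod_(l < m.+1 | l != k) x (tnth t l) 0.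
transitivity (\sum_(k < m.+1) \sum_(t : m.+1.-tuple 'I_n) A t * F k t).
  rewrite exchange_big /line_form raddf_sum/= horner_sum; apply: eq_bigr => t _.
  rewrite derivM derivC mul0r add0r hornerCM deriv_prod ?index_enum_uniq//.
  rewrite horner_sum -mulr_sumr; congr (_ * _); apply: eq_bigr => k _.
  rewrite deriv_line hornerCM horner_prod; congr (_ * _).
  by apply: eq_bigr => l _; rewrite horner_line scale0r addr0.
have F0 k : \sum_(t : m.+1.-tuple 'I_n) A t * F k t =
            dot h (tensor_apply A x).
  rewrite dot_tensor_apply.
  (* Reindex the multi-indices, then the slots, by the swap of k and 0. *)
  pose s := tperm k ord0.
  pose perm_tuple (t : m.+1.-tuple 'I_n) := [tuple tnth t (s l) | l < m.+1].
  have permK : involutive perm_tuple.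
    by move=> t; apply: eq_from_tnth => l; rewrite !tnth_mktuple tpermK.
  rewrite (reindex_inj (inv_inj permK)); apply: eq_bigr => t _.
  rewrite symA; congr (_ * _); rewrite /F tnth_mktuple tpermL; congr (_ * _).
  rewrite (reindex_inj (@perm_inj _ s)).
  rewrite (eq_bigl (fun l => l != ord0)) => [|l]; last first.
    by rewrite -{1}(tpermR k ord0) (inj_eq perm_inj).
  under eq_bigr do rewrite tnth_mktuple tpermK.
  case/tupleP: t => j t /=; rewrite big_mkcond big_ord_recl eqxx/= mul1r big_tuple.
  by apply: eq_bigr => l _; rewrite tnthS.
by rewrite (eq_bigr _ (fun k _ => F0 k)) sumr_const card_ord mulr_natl.
Qed.

Lemma poly_min_deriv_eq0 (R : realType) (p : {poly R}) (a : R) :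
  (forall s, p.[a] <= p.[s]) -> p^`().[a] = 0.
Proof.
move=> pmin.
have ain : a \in `]a - 1, a + 1[ by rewrite in_itv/=; apply/andP; split; lra.
have d0 : is_derive a 1 (horner p) 0.
  apply: (@derive1_at_min _ _ (a - 1) (a + 1)) => //; lra.
by rewrite -(@derive_val _ _ _ _ _ _ _ (is_derive_poly p a)) derive_val.
Qed.

(** * Minimum of the form on the unit sphere *)

(** Transposition bridges the compactness of bounded closed sets, which is used
    on row vectors, and the form, which takes column vectors. *)
Lemma continuous_tensor_form_tr (R : realType) (m n : nat) (A : tensor R m n) :
  continuous (fun v : 'rV[R]_n => tensor_form A v^T).
Proof.
apply: (@continuous_big _ _ +%R 0) => [|t _]; first exact: add_continuous.
have prod_cont : continuous (fun v : 'rV[R]_n => \prod_(j <- t) v^T j 0).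
  apply: (@continuous_big R _ (@GRing.mul R) 1) => [|j _]; first exact: mul_continuous.
  under [X in continuous X]funext do rewrite mxE.
  exact: coord_continuous.
by move=> v; apply: continuousM; [exact: cst_continuous|exact: prod_cont].
Qed.

Lemma continuous_dot_tr (R : realType) (n : nat) :
  continuous (fun v : 'rV[R]_n => dot v^T v^T).
Proof.
apply: (@continuous_big _ _ +%R 0) => [|i _]; first exact: add_continuous.
under [X in continuous X]funext do rewrite mxE.
by move=> v; apply: continuousM; exact: coord_continuous.
Qed.

Lemma compact_unit_sphere (R : realType) (n : nat) :
  compact [set v : 'rV[R]_n | dot v^T v^T = 1].
Proof.
apply: bounded_closed_compact.
  exists 1; split => // M M1 v /= v1.
  rewrite /Num.norm/= mx_normrE; apply/bigmax_leP; split => [|[i j] _]/=.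
    by rewrite (le_trans ler01)// ltW.
  apply: le_trans (ltW M1); rewrite -(@ler_pXn2r _ 2)// ?nnegrE//.
  rewrite real_normK ?num_real// expr1n -v1 /dot (bigD1 j)//= !mxE (ord1 i).
  by rewrite -expr2 lerDl sumr_ge0// => k _; rewrite mxE -expr2 sqr_ge0.
exact: (closed_comp (fun x _ => @continuous_dot_tr R n x) (@closed_eq _ 1)).
Qed.

(** The vector [x0] only witnesses that the sphere is nonempty, that is,
    that the dimension is positive. *)
Lemma tensor_form_sphere_min (R : realType) (m n : nat) (A : tensor R m n)
    (x0 : 'cV[R]_n) :
  dot x0 x0 = 1 ->
  exists2 c : 'cV[R]_n, dot c c = 1 &
    forall y, dot y y = 1 -> tensor_form A c <= tensor_form A y.
Proof.
move=> x01.
have S0 : [set v : 'rV[R]_n | dot v^T v^T = 1] !=set0.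
  by exists x0^T; rewrite /= trmxK.
have [|c] := EVT_min_rV S0 (@compact_unit_sphere R n) (f := fun v => tensor_form A v^T).
  exact/continuous_subspaceT/continuous_tensor_form_tr.
rewrite inE/= => c1 cmin; exists c^T => // y y1.
by have := cmin y^T; rewrite inE/= trmxK; exact.
Qed.

(** By homogeneity: a nonzero [y] is [enorm y] times a unit vector. *)
Lemma tensor_form_ge_enorm (R : realType) (m n : nat) (A : tensor R m.+1 n) (mu : R) :
  (forall y, dot y y = 1 -> mu <= tensor_form A y) ->
  forall y, mu * enorm y ^+ m.+1 <= tensor_form A y.
Proof.
move=> mule y; have [->|y0] := eqVneq y 0.
  have := tensor_formZ A 0 0; rewrite scale0r expr0n/= mul0r => ->.
  by rewrite (_ : enorm 0 = 0) ?expr0n ?mulr0//; apply/eqP; rewrite enorm_eq0.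
have ny : enorm y != 0 by rewrite enorm_eq0.
rewrite -{2}[y](scalerKV ny) tensor_formZ mulrC ler_pM2l; last first.
  by rewrite exprn_gt0// lt_def ny enorm_ge0.
apply: mule; rewrite dotZr dotC dotZr -sqr_enorm.
by field.
Qed.

(** First-order optimality at a minimiser [c], read on the squares of the form
    and of [mu * enorm y ^+ m.+1].  The squares are polynomials in [y], which
    [enorm y ^+ m.+1] is not when [m.+1] is odd; positivity of the minimum
    makes squaring monotone. *)
Lemma sphere_min_Z_eigenvalue (R : realType) (m n : nat) (A : tensor R m.+1 n)
    (c : 'cV[R]_n) :
  symmetric_tensor A -> 0 < tensor_form A c -> dot c c = 1 ->
  (forall y, dot y y = 1 -> tensor_form A c <= tensor_form A y) ->
  Z_eigenvalue A (tensor_form A c).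
Proof.
move=> symA; set mu := tensor_form A c => mu_gt0 c1 cmin.
exists c; split; last by rewrite mulmx_trE c1.
have stat h : dot h (tensor_apply A c + - mu *: c) = 0.
  pose P := line_form A c h ^+ 2 - (mu ^+ 2) *: line_sqnorm c h ^+ m.+1.
  have PE s : P.[s] = tensor_form A (c + s *: h) ^+ 2
      - (mu * enorm (c + s *: h) ^+ m.+1) ^+ 2.
    rewrite !hornerE horner_line_form horner_line_sqnorm exprMn.
    by rewrite -exprM mulnC exprM sqr_enorm.
  have P0 : P.[0] = 0.
    by rewrite PE scale0r addr0 -/mu enormE c1 sqrtr1 expr1n mulr1 subrr.
  have : P^`().[0] = 0.
    apply: poly_min_deriv_eq0 => s; rewrite P0 PE subr_ge0.
    rewrite ler_pXn2r ?nnegrE ?mulr_ge0 ?exprn_ge0 ?enorm_ge0 ?(ltW mu_gt0)//.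
      exact: tensor_form_ge_enorm.
    apply: le_trans (tensor_form_ge_enorm cmin _).
    by rewrite mulr_ge0 ?exprn_ge0 ?enorm_ge0 ?(ltW mu_gt0).
  rewrite derivB derivZ !deriv_exp hornerD hornerN hornerZ !hornerMn !hornerM.
  rewrite horner_exp deriv_line_form// deriv_line_sqnorm horner_exp.
  rewrite horner_line_form horner_line_sqnorm scale0r addr0 c1 expr1n -/mu.
  rewrite dotDr dotZr.
  set a := dot h _; set b := dot h _ => E.
  have : 2 * mu * m.+1%:R * (a + - mu * b) = 0.
    by rewrite -E /=; ring.
  move/eqP; rewrite !mulf_eq0 pnatr_eq0 (gt_eqF mu_gt0)/= pnatr_eq0/=.
  by move/eqP.
(* Take for h the vector A c^(m-1) - mu c itself. *)
by apply/eqP; rewrite -subr_eq0 -scaleNr -dot_eq0 stat.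
Qed.

(** * The smallest Z-eigenvalue of a positive definite tensor *)

Lemma Z_eigenvalue_gt0 (R : realType) (m n : nat)
    (A : tensor R m.+1 n) (lambda : R) :
  positive_definite A -> Z_eigenvalue A lambda -> 0 < lambda.
Proof.
move=> pdA [x [Ax /mulmx_tr_scalar x1]].
have x0 : x != 0 by rewrite -dot_eq0 x1 oner_eq0.
by have := pdA x x0; rewrite -dot_tensor_apply_self Ax dotZr x1 mulr1.
Qed.

(** The minimum of the form on the sphere is a Z-eigenvalue, hence at least the
    smallest one.  The eigenvector that comes with [lambda] shows that the
    sphere is nonempty. *)
Lemma smallest_Z_eigenvalue_le_form (R : realType) (m n : nat)
    (A : tensor R m.+1 n) (lambda : R) (x : 'cV[R]_n) :
  symmetric_tensor A -> positive_definite A -> smallest_Z_eigenvalue A lambda ->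
  lambda * enorm x ^+ m.+1 <= tensor_form A x.
Proof.
move=> symA pdA [[x0 [_ /mulmx_tr_scalar x01]] lambda_le].
have [c c1 cmin] := tensor_form_sphere_min A x01.
have c0 : c != 0 by rewrite -dot_eq0 c1 oner_eq0.
apply: tensor_form_ge_enorm => y y1; apply: le_trans (cmin y y1).
exact/lambda_le/sphere_min_Z_eigenvalue/cmin/c1/pdA/c0.
Qed.

Theorem theorem5 (R : realType) (m n : nat) (hm : (2 <= m)%N) (hn : (1 <= n)%N)
    (A : tensor R m n) (q : 'cV[R]_n) (lambda_min : R)
    (hsym : symmetric_tensor A) (hpd : positive_definite A)
    (hmin : smallest_Z_eigenvalue A lambda_min) :
  TCP_solutions A q `<=`
  [set x : 'cV[R]_n | enorm x <= (enorm q / lambda_min) `^ (m.-1%:R^-1)].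
Proof.
case: m hm A hsym hpd hmin => [//|[//|m]] _ A hsym hpd hmin x [_ _] /=.
rewrite -(raddf0 (@scalar_mx R 1)) => /mulmx_tr_scalar compl.
have lambda_gt0 := Z_eigenvalue_gt0 hpd hmin.1.
have := enorm_ge0 x; rewrite le_eqVlt => /predU1P[<-|x_gt0].
  exact: powR_ge0.
have bound : enorm x ^+ m.+1 <= enorm q / lambda_min.
  rewrite ler_pdivlMr// mulrC -(ler_pM2l x_gt0) mulrCA -exprS.
  apply: le_trans (smallest_Z_eigenvalue_le_form x hsym hpd hmin) _.
  apply: le_trans (ler_oppdot_enorm x q).
  by move: compl; rewrite dotDr dot_tensor_apply_self => /eqP; rewrite addr_eq0 => /eqP->.
have -> : enorm x = (enorm x ^+ m.+1) `^ (m.+1%:R^-1).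
  by rewrite -powR_mulrn ?ltW// -powRrM divff ?pnatr_eq0// powRr1 ?ltW.
have ratio_ge0 : 0 <= enorm q / lambda_min.
  by rewrite divr_ge0 ?enorm_ge0 ?ltW.
by apply: ge0_ler_powR; rewrite ?nnegrE ?invr_ge0 ?ler0n ?exprn_ge0 ?enorm_ge0.
Qed.
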